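(* Consider a recurrent $\mathrm{IFS}(T_1,\dots,T_k;\mathbb P^+)$ ($k\ge2$) of continuous maps of a compact metric space $X$ such that $\mathbb P^-$ is mixing and $\mathbb P^-(S_{\mathrm t})=1$. Then $$\lim_{n\to\infty}\mathfrak S^n(\widehat\mu)=\varpi_*\mathbb P^-\quad\text{for every }\widehat\mu\in\mathcal M_1(\widehat X),$$ where $\mathfrak S=\mathfrak S_{\mathbb P^+}$ is the (generalised) Markov operator of the recurrent IFS. In particular, $\varpi_*\mathbb P^-$ is the unique stationary measure of $\mathfrak S$.
   Context: $\Sigma_k^+=\{1,\dots,k\}^{\mathbb N}$ with left shift $\sigma(\xi)_n=\xi_{n+1}$, and cylinders $[a_0\dots a_\ell]=\{\omega\in\Sigma_k^+:\omega_0=a_0,\dots,\omega_\ell=a_\ell\}$. The set of weakly hyperbolic sequences is $S_{\mathrm t}=\{\xi\in\Sigma_k^+ : \lim_{n\to\infty}\mathrm{diam}(T_{\xi_0}\circ\cdots\circ T_{\xi_n}(X))=0\}$, and the coding map $\pi\colon S_{\mathrm t}\to X$ is $\pi(\xi)=\lim_{n\to\infty}T_{\xi_0}\circ\cdots\circ T_{\xi_n}(p)$, independent of $p\in X$. A transition matrix is a $k\times k$ matrix $P=(p_{ij})$ with $p_{ij}\ge0$ and $\sum_jp_{ij}=1$ for every $i$. It is irreducible if for all $\ell,r$ some power $P^n$ has positive $(\ell,r)$ entry; it then has a unique stationary probability vector $\bar p=(p_1,\dots,p_k)$, $\bar pP=\bar p$. The associated Markov measure $\mathbb P^+$ is the Borel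 probability on $\Sigma_k^+$ with $\mathbb P^+([a_0\dots a_\ell])=p_{a_0}p_{a_0a_1}\cdots p_{a_{\ell-1}a_\ell}$. A recurrent IFS $\mathrm{IFS}(T_1,\dots,T_k;\mathbb P^+)$ consists of the maps together with the Markov measure $\mathbb P^+$ of an irreducible transition matrix $P$. The inverse Markov measure $\mathbb P^-$ is the (Markov) measure on $\Sigma_k^+$ with $\mathbb P^-([a_0a_1\dots a_n])=\mathbb P^+([a_n\dots a_1a_0])$. A measure $\mu$ on $\Sigma_k^+$ is mixing if $\lim_{n\to\infty}\mu(\sigma^{-n}(A)\cap B)=\mu(A)\mu(B)$ for all Borel $A,B$. Let $\widehat X=X\times\{1,\dots,k\}$ with the product topology, and $\mathcal M_1(\widehat X)$ the Borel probability measures on $\widehat X$ with the weak$*$ topology. For $\widehat B\subset\widehat X$ put $\widehat B_j=\{x\in X:(x,j)\in\widehat B\}$, and for $\widehat\mu\in\mathcal M_1(\widehat X)$ put $\mu_i(B)=\widehat\mu(B\times\{i\})$. The (generalised) Markov operator $\mathfrak S_{\mathbb P^+}\colon\mathcal M_1(\widehat X)\to\mathcal M_1(\widehat X)$ is $\mathfrak S_{\mathbb P^+}(\widehat\mu)(\widehat B)=\sum_{i,j}p_{ij}\,T_{j*}\mu_i(\widehat B_j)$, where $T_{j*}\mu_i(A)=\mu_i(T_j^{-1}(A))$. A stationary measure is a fixed point of $\mathfrak S_{\mathbb P^+}$. The generalised coding map is $\varpi\colon S_{\mathrm t}\to\widehat X$, $\varpi(\xi)=(\pi(\xi),\xi_0)$,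 and $\varpi_*\mathbb P^-$ is the measure $\widehat B\mapsto\mathbb P^-(\varpi^{-1}(\widehat B))$ on $\widehat X$. *)

(* Defs.v *)
From HB Require Import structures.
From mathcomp Require Import all_boot all_order all_algebra.
From mathcomp Require Import all_classical all_reals all_analysis.

Set Implicit Arguments.
Unset Strict Implicit.
Unset Printing Implicit Defensive.

Import Order.TTheory GRing.Theory Num.Theory.
Import numFieldNormedType.Exports.

Local Open Scope classical_set_scope.
Local Open Scope ring_scope.

(* A nonempty metric space: measurable types have to be pointed. *)
#[short(type="pmetricType")]
HB.structure Definition PointedMetric (K : numDomainType) :=
  {M of Metric K M & Pointed M}.

HB.instance Definition _ (T U : ptopologicalType) := Pointed.on (T * U)%type.

Definition borel (T : ptopologicalType) := g_sigma_algebraType (@open T).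
HB.instance Definition _ (T : ptopologicalType) := Measurable.on (borel T).

Section weakstar.
Context (R : realType) (T : ptopologicalType).

Definition weakstar_eval (mu : probability (borel T) R) :
    {ptws continuousType T R -> R} :=
  fun f => \int[mu]_x f x.

(* Borel probability measures with the coarsest topology making all
   mu |-> \int[mu]_x f x, f continuous, continuous (used for compact T only, so
   that such f are bounded). A [probability] also has (meaningless) values on
   nonmeasurable sets, so limits are unique only as measures, i.e., up to
   agreement on measurable sets. *)
Definition weakstar := initial_topology weakstar_eval.
HB.instance Definition _ := Topological.on weakstar.

Lemma weakstar_cvgP (u : nat -> probability (borel T) R)
    (mu : probability (borel T) R) :
  (u n : weakstar) @[n --> \oo] --> (mu : weakstar) <->
  forall f : continuousType T R,
    (\int[u n]_x f x) @[n --> \oo] --> \int[mu]_x f x.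
Proof.
set eval := weakstar_eval.
have evalP : eval (u n) @[n --> \oo] --> eval mu <->
    (u n : weakstar) @[n --> \oo] --> (mu : weakstar).
  split=> [h|h]; last first.
    by apply: cvg_comp h _; exact: (@initial_continuous _ _ eval mu).
  move=> A [_ [[B oB <-] Bmu] BA].
  apply: filterS BA _; apply: h; exact: open_nbhs_nbhs.
rewrite -evalP; split => [h f|h].
  have := @proj_continuous _ (fun _ : continuousType T R => R) f (eval mu).
  exact: cvg_comp h.
apply/cvg_sup => f A [_ [[B oB <-] Bmu] BA].
apply: filterS BA _; apply: (h f); exact: open_nbhs_nbhs.
Qed.

End weakstar.

(* The alphabet {1, ..., k} with k = m.+1, as a discrete space. *)
Definition symbol (m : nat) : Type := discrete_topology 'I_m.+1.
HB.instance Definition _ m :=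
  DiscreteUniform.copy (symbol m) (discrete_topology 'I_m.+1).
HB.instance Definition _ (R : realType) m :=
  @DiscretePseudoMetric_ofUniform.Build R (symbol m).
HB.instance Definition _ m := isPointed.Build (symbol m) ord0.
HB.instance Definition _ m := Finite.copy (symbol m) 'I_m.+1.

Definition sequences (m : nat) := prod_topology (fun _ : nat => symbol m).
HB.instance Definition _ m := Uniform.on (sequences m).
HB.instance Definition _ m := Pointed.copy (sequences m) (nat -> symbol m).

Definition shift m (xi : sequences m) : sequences m := fun n => xi n.+1.

(* The cylinder [a_0 ... a_l]; only the first l.+1 terms of a matter. *)
Definition cylinder m (a : nat -> symbol m) (l : nat) : set (sequences m) :=
  [set w | forall i, (i <= l)%N -> w i = a i].

Section markov_chain.
Context (R : realType) (m : nat).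

Record transition_matrix := TransitionMatrix {
  transition_mx :> 'M[R]_m.+1;
  transition_ge0 : forall i j, 0 <= transition_mx i j;
  transition_sum1 : forall i, \sum_j transition_mx i j = 1 }.

Definition irreducible_mx (P : 'M[R]_m.+1) :=
  forall l r, exists2 n, (0 < n)%N & 0 < (P ^+ n) l r.

Definition stationary_vector (P : 'M[R]_m.+1) (p : 'rV[R]_m.+1) :=
  [/\ forall i, 0 <= p ord0 i, \sum_i p ord0 i = 1 & p *m P = p].

Definition markov_measure (P : 'M[R]_m.+1) (p : 'rV[R]_m.+1)
    (mu : probability (borel (sequences m)) R) :=
  forall (a : nat -> symbol m) l,
    mu (cylinder a l) = (p ord0 (a 0%N) * \prod_(i < l) P (a i) (a i.+1))%:E.

Definition inverse_measure (mu nu : probability (borel (sequences m)) R) :=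
  forall (a : nat -> symbol m) l,
    nu (cylinder a l) = mu (cylinder (fun i => a (l - i)%N) l).

Definition mixing (mu : probability (borel (sequences m)) R) :=
  forall A B : set (borel (sequences m)), measurable A -> measurable B ->
    mu ((iter n (@shift m) @^-1` A) `&` B) @[n --> \oo] --> (mu A * mu B)%E.

End markov_chain.

Definition diam (R : realType) (X : metricType R) (A : set X) : \bar R :=
  ereal_sup [set (mdist x y)%:E | x in A & y in A].

Section coding.
Context (R : realType) (X : pmetricType R) (m : nat).
Context (T : symbol m -> continuousType X X).

(* T_{xi_0} \o ... \o T_{xi_n} *)
Fixpoint comp_maps (xi : sequences m) (n : nat) : X -> X :=
  if n is n'.+1 then comp_maps xi n' \o T (xi n) else T (xi 0%N).

Definition weakly_hyperbolic : set (sequences m) :=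
  [set xi | diam (range (comp_maps xi n)) @[n --> \oo] --> 0%E].

(* Only meaningful on weakly hyperbolic sequences. *)
Definition coding (xi : sequences m) : X :=
  lim (comp_maps xi n point @[n --> \oo]).

Definition gcoding (xi : sequences m) : X * symbol m := (coding xi, xi 0%N).

Definition gcoding_image (mu : probability (borel (sequences m)) R)
    (B : set (borel (X * symbol m)%type)) : \bar R :=
  mu (weakly_hyperbolic `&` gcoding @^-1` B).

Lemma open_cylinder_determined n (A : set (sequences m)) :
  (forall xi eta : sequences m,
    (forall i, (i <= n)%N -> eta i = xi i) -> A xi -> A eta) -> open A.
Proof.
move=> hA; rewrite openE => xi Axi; rewrite /interior.
have /= : nbhs xi (fun eta : sequences m => forall i : 'I_n.+1, eta i = xi i).
  apply: (@filter_forall (sequences m) 'I_n.+1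
    (fun i eta => eta i = xi i) (nbhs xi) (nbhs_filter xi)) => i.
  have := @proj_continuous nat (fun _ => symbol m) i xi [set (xi i)].
  by apply; exact: discrete_set1.
apply: filterS => eta h; apply: hA Axi => i ni.
exact: (h (Ordinal (ni : (i < n.+1)%N))).
Qed.

Lemma comp_maps_eq (xi eta : sequences m) n :
  (forall i, (i <= n)%N -> eta i = xi i) -> comp_maps eta n = comp_maps xi n.
Proof.
elim: n => [|n ih] h /=; first by rewrite h.
by rewrite (h n.+1)// ih// => i ni; apply: h; rewrite (leq_trans ni).
Qed.

Lemma diam_ge0 n xi : (0 <= diam (range (comp_maps xi n)))%E.
Proof.
apply: ereal_sup_ubound; exists (comp_maps xi n point); first by exists point.
by exists (comp_maps xi n point); [exists point|rewrite mdistxx].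
Qed.

Lemma mdist_diam (A : set X) x y : A x -> A y -> ((mdist x y)%:E <= diam A)%E.
Proof. by move=> Ax Ay; apply: ereal_sup_ubound; exists x => //; exists y. Qed.

Lemma weakly_hyperbolic_lt xi e : weakly_hyperbolic xi -> 0 < e ->
  \forall n \near \oo, (diam (range (comp_maps xi n)) < e%:E)%E.
Proof.
move=> hxi e0; apply: (hxi [set x | (x < e%:E)%E]).
apply: open_nbhs_nbhs; split; first exact: open_ereal_lt_ereal.
by rewrite /= lte_fin.
Qed.

Lemma weakly_hyperbolicE : weakly_hyperbolic =
  \bigcap_k \bigcup_N \bigcap_(n in [set n | (N <= n)%N])
    [set xi | diam (range (comp_maps xi n)) < k.+1%:R^-1%:E]%E.
Proof.
have k0 (k : nat) : 0 < k.+1%:R^-1 :> R by rewrite invr_gt0.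
apply/seteqP; split => [xi /= hxi k _|xi hxi].
  have [N _ hN] := weakly_hyperbolic_lt hxi (k0 k).
  by exists N.
rewrite /weakly_hyperbolic /=.
have fin : \forall n \near \oo,
    diam (range (comp_maps xi n)) \is a fin_num.
  have [N _ hN] := hxi 0%N I; exists N => // n Nn.
  rewrite ge0_fin_numE ?diam_ge0//.
  exact: (lt_trans (hN n Nn) (ltry _)).
apply/fine_cvgP; split => //.
apply/cvgrPdist_lt => e e0.
have [k ke] : exists k : nat, k.+1%:R^-1 < e.
  by near \oo%classic => k; exists k; near: k; exact: near_infty_natSinv_lt (PosNum e0).
have [N _ hN] := hxi k I.
near=> n.
have h : (diam (range (comp_maps xi n)) < k.+1%:R^-1%:E)%E.
  by apply: hN => /=; near: n; exists N.
rewrite sub0r normrN /= ger0_norm ?fine_ge0 ?diam_ge0//.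
rewrite (lt_trans _ ke)// -lte_fin fineK//.
by near: n.
Unshelve. all: by end_near. Qed.

Lemma measurable_open (U : ptopologicalType) (A : set (borel U)) :
  @open U A -> measurable A.
Proof. by move=> oA; exact: sub_sigma_algebra. Qed.

Lemma measurable_weakly_hyperbolic :
  measurable (weakly_hyperbolic : set (borel (sequences m))).
Proof.
rewrite weakly_hyperbolicE; apply: bigcap_measurable => // k _.
apply: bigcup_measurable => N _; apply: bigcap_measurable.
  by exists N => /=.
move=> n _; apply: measurable_open.
apply: (@open_cylinder_determined n) => xi eta h /=.
by rewrite (comp_maps_eq h).
Qed.

Context (cptX : compact [set: X]).

Lemma comp_maps_range xi n d :
  range (comp_maps xi (n + d)) `<=` range (comp_maps xi n).
Proof.
elim: d => [|d ih]; first by rewrite addn0.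
by rewrite addnS => _ [x _ <-]; apply: ih; exists (T (xi (n + d).+1) x).
Qed.

Lemma coding_cvg xi : weakly_hyperbolic xi ->
  comp_maps xi n point @[n --> \oo] --> coding xi.
Proof.
move=> hxi; apply: (@compact_cauchy_cvg X [set: X]) => //; last exact: filterT.
apply/cauchyP => e e0.
have [N _ hN] := weakly_hyperbolic_lt hxi e0.
exists (comp_maps xi N point); exists N => // n /= Nn.
rewrite ballEmdist /= -lte_fin; apply: le_lt_trans (hN N (leqnn _)).
apply: mdist_diam; first by exists point.
by rewrite -(subnKC Nn); apply: (@comp_maps_range _ N (n - N)%N); exists point.
Qed.

Lemma gcoding_preimageE (U : set (X * symbol m)) : open U ->
  weakly_hyperbolic `&` gcoding @^-1` U =
  weakly_hyperbolic `&` \bigcup_k \bigcup_N \bigcap_(n in [set n | (N <= n)%N])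
    [set xi | forall z, ball (comp_maps xi n point) k.+1%:R^-1 z ->
                        U (z, xi 0%N)].
Proof.
move=> oU; apply/seteqP; split => xi [hxi h]; (split; first by []).
  have /nbhs_ballP [e /= e0 eU] : nbhs (gcoding xi) U.
    by apply: open_nbhs_nbhs.
  have e20 : 0 < e / 2 by rewrite divr_gt0.
  have [k ke] : exists k : nat, k.+1%:R^-1 < e / 2.
    near \oo%classic => k; exists k.
    by near: k; exact: near_infty_natSinv_lt (PosNum e20).
  have [N _ hN] : \forall n \near \oo,
      ball (coding xi) (e / 2) (comp_maps xi n point).
    by apply: (coding_cvg hxi); exact: nbhsx_ballx.
  exists k => //; exists N => // n Nn z hz; apply: eU; split => //=.
  rewrite [e]splitr; apply: ball_triangle (hN n Nn) _.
  exact: le_ball (ltW ke) _ hz.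
case: h => k _ [N _ hN].
have k0 : 0 < k.+1%:R^-1 :> R by rewrite invr_gt0.
have [N' _ hN'] : \forall n \near \oo,
    ball (coding xi) k.+1%:R^-1 (comp_maps xi n point).
  by apply: (coding_cvg hxi); exact: nbhsx_ballx.
apply: (hN (maxn N N')); first exact: leq_maxl.
by apply: ball_sym; apply: hN'; exact: leq_maxr.
Unshelve. all: by end_near. Qed.

Lemma measurable_gcoding :
  measurable_fun (weakly_hyperbolic : set (borel (sequences m)))
    (gcoding : borel (sequences m) -> borel (X * symbol m)%type).
Proof.
apply: (@measurability _ _ (borel (sequences m)) (borel (X * symbol m)%type)
  _ _ (@open (X * symbol m)%type)) => [//|_ [U oU <-]].
rewrite gcoding_preimageE//; apply: measurableI.
  exact: measurable_weakly_hyperbolic.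
apply: bigcup_measurable => k _; apply: bigcup_measurable => N _.
apply: bigcap_measurable; first by exists N => /=.
move=> n _; apply: measurable_open.
apply: (@open_cylinder_determined n) => xi eta h /= hU z.
by rewrite (comp_maps_eq h) (h 0%N)//; exact: hU.
Qed.

End coding.

(* The image of mu under gcoding, restricted to weakly hyperbolic sequences;
   compactness of X makes gcoding measurable there. *)
Section gcoding_pushforward.
Context (R : realType) (X : pmetricType R) (m : nat).
Context (T : symbol m -> continuousType X X).
Context (mu : probability (borel (sequences m)) R).
Context (cptX : compact [set: X]) (mu1 : mu (weakly_hyperbolic T) = 1%E).

Let gcoding_image0 : gcoding_image T mu set0 = 0%E.
Proof. by rewrite /gcoding_image preimage_set0 setI0 measure0. Qed.

Let gcoding_image_ge0 B : (0 <= gcoding_image T mu B)%E.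
Proof. exact: measure_ge0. Qed.

Let gcoding_image_sigma_additive : semi_sigma_additive (gcoding_image T mu).
Proof.
move=> F mF tF mUF; rewrite /gcoding_image preimage_bigcup setI_bigcupr.
apply: measure_semi_sigma_additive.
- by move=> n; apply: measurable_gcoding => //; exact: measurable_weakly_hyperbolic.
- apply/trivIsetP => i j _ _ ij; move/trivIsetP : tF => /(_ i j I I ij) Fij.
  by rewrite setIACA setIid -preimage_setI Fij preimage_set0 setI0.
- rewrite -setI_bigcupr -preimage_bigcup.
  by apply: measurable_gcoding => //; exact: measurable_weakly_hyperbolic.
Qed.

Let gcoding_imageT : gcoding_image T mu setT = 1%E.
Proof. by rewrite /gcoding_image preimage_setT setIT. Qed.

Let gcoding_measure :
    {measure set (borel (X * symbol m)%type) -> \bar R} :=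
  HB.pack (gcoding_image T mu)
    (isMeasure.Build _ _ _ (gcoding_image T mu)
      gcoding_image0 gcoding_image_ge0 gcoding_image_sigma_additive).

Definition gcoding_pushforward : probability (borel (X * symbol m)%type) R :=
  HB.pack (gcoding_image T mu) gcoding_measure
    (Measure_isProbability.Build _ _ _ gcoding_measure gcoding_imageT).

Lemma gcoding_pushforwardE B : gcoding_pushforward B = gcoding_image T mu B.
Proof. by []. Qed.

End gcoding_pushforward.

Section markov_operator.
Context (R : realType) (X : pmetricType R) (m : nat).
Context (P : transition_matrix R m) (T : symbol m -> continuousType X X).

Definition fiber (B : set (borel (X * symbol m)%type)) (j : symbol m) :
    set (borel X) := [set x | B (x, j)].

Definition slice (mu : set (borel (X * symbol m)%type) -> \bar R)
  (i : symbol m) (B : set (borel X)) : \bar R := mu (B `*` [set i]).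

Definition markov_fun (mu : set (borel (X * symbol m)%type) -> \bar R)
    (B : set (borel (X * symbol m)%type)) : \bar R :=
  (\sum_(i : symbol m) \sum_(j : symbol m)
    (P i j)%:E *
    pushforward (slice mu i) (T j : borel X -> borel X) (fiber B j))%E.

Lemma measurable_continuous (U V : ptopologicalType) (f : U -> V) :
  continuous f -> measurable_fun setT (f : borel U -> borel V).
Proof.
move=> /continuousP cf.
apply: (@measurability _ _ (borel U) (borel V) _ _ (@open V)) => [//|_ [B oB <-]].
by rewrite setTI; apply: measurable_open; exact: cf.
Qed.

Let Phi (j : symbol m) (z : borel (X * symbol m)%type) :
  borel (X * symbol m)%type := (T j z.1, j).

Let measurable_Phi j : measurable_fun setT (Phi j).
Proof.
apply: (@measurable_continuous (X * symbol m)%type (X * symbol m)%type) => z.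
have Tc : {for z, continuous (fun z : X * symbol m => T j z.1)}.
  by apply: continuous_comp; [exact: cvg_fst | exact: cts_fun].
exact: (cvg_pair Tc (cvg_cst j)).
Qed.

Let measurable_slice (i : symbol m) :
  measurable ([set z | z.2 = i] : set (borel (X * symbol m)%type)).
Proof.
apply: measurable_open.
have : continuous (@snd X (symbol m)) by move=> z; exact: cvg_snd.
by move=> /continuousP /(_ [set i]); apply; exact: discrete_open.
Qed.

Context (mu : probability (borel (X * symbol m)%type) R).

Let pieceE i j B :
  pushforward (slice mu i) (T j : borel X -> borel X) (fiber B j) =
  mu (Phi j @^-1` B `&` [set z | z.2 = i]).
Proof.
by rewrite /pushforward /slice; congr (mu _); apply/seteqP; split => -[x l].
Qed.

Let markov_fun0 : markov_fun mu set0 = 0%E.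
Proof.
rewrite /markov_fun big1// => i _; rewrite big1// => j _.
by rewrite pieceE preimage_set0 set0I measure0 mule0.
Qed.

Let markov_fun_ge0 B : (0 <= markov_fun mu B)%E.
Proof.
apply: sume_ge0 => i _; apply: sume_ge0 => j _.
by rewrite mule_ge0 ?lee_fin ?transition_ge0// /pushforward /slice measure_ge0.
Qed.

Let markov_fun_sigma_additive : semi_sigma_additive (markov_fun mu).
Proof.
move=> F mF tF mUF.
have mPhi j B : measurable B -> measurable (Phi j @^-1` B).
  by move=> mB; rewrite -[X in measurable X]setTI; exact: measurable_Phi.
have -> : markov_fun mu (\bigcup_n F n) =
    (\sum_(n <oo) markov_fun mu (F n))%E; last first.
  by apply: is_cvg_nneseries => n _ _; exact: markov_fun_ge0.
have pos i j n : (0 <= (P i j)%:E *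
    pushforward (slice mu i) (T j : borel X -> borel X) (fiber (F n) j))%E.
  by rewrite mule_ge0 ?lee_fin ?transition_ge0// /pushforward /slice measure_ge0.
rewrite /markov_fun nneseries_sum; last first.
  by move=> i n _; apply: sume_ge0 => j _; exact: pos.
apply: eq_bigr => i _; rewrite nneseries_sum; last by move=> j n _; exact: pos.
apply: eq_bigr => j _; rewrite nneseriesZl; last first.
  by move=> n _; rewrite /pushforward /slice measure_ge0.
rewrite pieceE preimage_bigcup setI_bigcupl measure_semi_bigcup.
- by congr (_ * _)%E; apply: eq_eseriesr => n _; rewrite pieceE.
- by move=> n; exact: measurableI (mPhi j _ (mF n)) (measurable_slice i).
- apply/trivIsetP => a b _ _ ab; move/trivIsetP : tF => /(_ a b I I ab) Fab.
  by rewrite setIACA -preimage_setI Fab preimage_set0 set0I.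
- rewrite -setI_bigcupl -preimage_bigcup.
  exact: measurableI (mPhi j _ mUF) (measurable_slice i).
Qed.

Let markov_funT : markov_fun mu setT = 1%E.
Proof.
rewrite /markov_fun (eq_bigr (fun i => mu [set z | z.2 = i])) => [|i _]; last first.
  under eq_bigr do rewrite pieceE preimage_setT setTI.
  rewrite -ge0_sume_distrl; last by move=> j _; rewrite lee_fin transition_ge0.
  by rewrite sumEFin (transition_sum1 P) mul1e.
rewrite -(probability_setT mu).
transitivity (mu (\big[setU/set0]_(i < m.+1)
    ([set z | z.2 = i] : set (borel (X * symbol m)%type)))).
  apply/esym; apply: (@measure_bigsetU_ord _ _ _ mu m.+1 predT) => [i|].
    exact: measurable_slice.
  by apply/trivIsetP => a b _ _ /eqP ab; apply/seteqP; split => // z /= [-> /ab].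
congr (mu _); apply/seteqP; split => // z _.
by rewrite (bigD1 (z.2 : 'I_m.+1))//=; left.
Qed.

Let markov_measure_fun :
    {measure set (borel (X * symbol m)%type) -> \bar R} :=
  HB.pack (markov_fun mu)
    (isMeasure.Build _ _ _ (markov_fun mu)
      markov_fun0 markov_fun_ge0 markov_fun_sigma_additive).

Definition markov_operator : probability (borel (X * symbol m)%type) R :=
  HB.pack (markov_fun mu) markov_measure_fun
    (Measure_isProbability.Build _ _ _ markov_measure_fun markov_funT).

Lemma markov_operatorE B : markov_operator B = markov_fun mu B.
Proof. by []. Qed.

Definition stationary_measure :=
  forall B : set (borel (X * symbol m)%type), measurable B ->
    markov_operator B = mu B.

End markov_operator.

(* Main.v *)
Require Import Defs.
From HB Require Import structures.
From mathcomp Require Import all_boot all_order all_algebra.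
From mathcomp Require Import all_classical all_reals all_analysis.
From mathcomp Require Import measurable_realfun lra.
Import Order.TTheory GRing.Theory Num.Theory.
Import numFieldNormedType.Exports.
Set Implicit Arguments.
Unset Strict Implicit.
Unset Printing Implicit Defensive.
Local Open Scope classical_set_scope.
Local Open Scope ring_scope.

(** Write L f (x, i) = sum_j p_ij f (T_j x, j) for a continuous function f on
the product of X and the alphabet. The Markov operator is dual to L
([Rintegral_markov_operator]): the integral of f against the n-th iterate of mu
is the integral of L^n f against mu. So it is enough to show that L^n f
converges uniformly to the constant c, the integral of f against the coding
measure; this handles all initial measures mu at once.

Expanding L^n f (x, i) gives a sum over the words i a_1 ... a_n of
p_{i a_1} ... p_{a_{n-1} a_n} f (T_{a_n} ... T_{a_1} x, a_n). Multiplied by p_i,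
the weight is the probability of the word under the forward chain, that is, the
probability of the reversed word a_n ... a_1 i under the inverse measure Q. Read
backwards, the maps are composed in the order of the coding map, whence
([iter_transferE])
  p_i L^n f (x, i) = E_Q [1_{xi_n = i} f (T_{xi_0} ... T_{xi_{n-1}} x, xi_0)].

Weak hyperbolicity now acts: outside a set of small Q-measure, there is an N
such that T_{xi_0} ... T_{xi_N} (X) has diameter less than a prescribed r, so
by uniform continuity the value of f above is, for all n > N and all x, close to
the value g_N obtained from the first N + 1 maps at a base point, and also close
to f at the coded point of xi. As g_N depends on finitely many symbols, mixing
applied to cylinders gives E_Q [1_{xi_n = i} g_N] -> p_i E_Q [g_N], and
E_Q [g_N] is close to c. Dividing by p_i, which is positive by irreducibility,
gives the uniform convergence ([iter_transfer_cvg]).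

Stationarity of the coding measure and uniqueness follow: both amount to two
probability measures having the same integrals of continuous functions, and such
measures agree on Borel sets ([probability_eq_continuous]). *)

(** * Measurability and integrals of bounded functions *)

Lemma measurable_continuous_real (R : realType) (Y : ptopologicalType) (f : Y -> R) :
  continuous f -> measurable_fun setT (f : borel Y -> R).
Proof.
move=> /continuousP cf.
apply: (measurability _ (RGenOInfty.measurableE R)).
move=> _ [_ [x ->] <-]; rewrite setTI; apply: measurable_open; apply: cf.
exact: interval_open.
Qed.

Lemma measurable_closed (U : ptopologicalType) (A : set (borel U)) :
  @closed U A -> measurable A.
Proof.
move=> cA; have := measurableC (measurable_open (closed_openC cA)).
by rewrite setCK.
Qed.

Lemma measure_conull d (S : measurableType d) (R : realType)
    (mu : {measure set S -> \bar R}) (A D : set S) :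
  measurable A -> measurable D -> mu (~` D) = 0%E -> mu A = mu (A `&` D).
Proof.
move=> mA mD D0; rewrite (measureDI mu mA mD) -[RHS]add0e.
congr (_ + _)%E; apply/eqP; rewrite -measure_le0 -D0 le_measure ?inE//.
  exact: measurableD.
exact: measurableC.
Qed.

(** The complement of D is null for the restricted measure, and on D the two
measures coincide. *)
Lemma ge0_integral_mrestr d (S : measurableType d) (R : realType)
    (mu : {measure set S -> \bar R}) (D : set S) (mD : measurable D)
    (f : S -> \bar R) :
  measurable_fun setT f -> (forall x, 0 <= f x)%E ->
  (\int[mrestr mu mD]_x f x = \int[mu]_(x in D) f x)%E.
Proof.
move=> mf f0; have mDC := measurableC mD.
rewrite -(setvU D) ge0_integral_setU//; last 2 first.
- exact: measurable_funTS.
- by apply/disj_setPS => x [].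
rewrite [X in (X + _)%E](eq_measure_integral mzero); last first.
  move=> A mA AD; rewrite /= /mrestr /mzero.
  by rewrite (_ : A `&` D = set0) ?measure0//; apply/disjoints_subset.
rewrite integral_measure_zero add0e; apply: eq_measure_integral => A mA AD.
by rewrite /= /mrestr setIidl.
Qed.

Section bounded_functions.
Context d (S : measurableType d) (R : realType) (mu : probability S R).
Implicit Types (f g : S -> R) (A : set S).

Lemma integrable_bounded f (M : R) : measurable_fun setT f ->
  (forall x, `|f x| <= M) -> mu.-integrable setT (EFin \o f).
Proof.
move=> mf fM; apply: measurable_bounded_integrable => //.
  by rewrite (le_lt_trans (probability_le1 mu measurableT)) ?ltry.
exists M; split; first exact: num_real.
by move=> N MN x _ /=; rewrite (le_trans (fM x))// ltW.
Qed.

Lemma integrable_scale f (k : R) : mu.-integrable setT (EFin \o f) ->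
  mu.-integrable setT (EFin \o (fun x => k * f x)).
Proof. by move=> intf; exact: (integrableZl measurableT k intf). Qed.

Lemma Rintegral_indic A : measurable A -> \int[mu]_x \1_A x = fine (mu A).
Proof. by move=> mA; rewrite /Rintegral integral_indic// setIT. Qed.

Lemma Rintegral_sum (I : Type) (s : seq I) (f : I -> S -> R) :
  (forall i, mu.-integrable setT (EFin \o f i)) ->
  \int[mu]_x (\sum_(i <- s) f i x) = \sum_(i <- s) \int[mu]_x f i x.
Proof.
move=> intf; rewrite /Rintegral.
under eq_integral do rewrite -sumEFin.
rewrite integral_sum//.
apply/esym/sum_fine => i _; exact: integrable_fin_num (intf i).
Qed.

Lemma Rintegral_cst1 (e : R) : \int[mu]_(_ in setT) e = e.
Proof.
rewrite Rintegral_cst// -[RHS]mulr1; congr (_ * _).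
by rewrite (_ : 1 = fine 1%E)//; congr fine; exact: probability_setT.
Qed.

(** The quantitative form in which convergence in measure of uniformly bounded
functions is used: an error e on A, and the trivial bound 2 M off A. *)
Lemma dist_Rintegral f g A (M e : R) : measurable A ->
  measurable_fun setT f -> measurable_fun setT g ->
  (forall x, `|f x| <= M) -> (forall x, `|g x| <= M) ->
  0 <= e -> (forall x, A x -> `|f x - g x| <= e) ->
  `|\int[mu]_x f x - \int[mu]_x g x| <= e + 2 * M * fine (mu (~` A)).
Proof.
move=> mA mf mg fM gM e0 fge.
have intf := integrable_bounded mf fM.
have intg := integrable_bounded mg gM.
have mfg : measurable_fun setT (f \- g) by exact: measurable_funB.
have fgM x : `|f x - g x| <= M + M.
  by rewrite (le_trans (ler_normB _ _))// lerD.
have intfg := integrable_bounded mfg fgM.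
rewrite -RintegralB//; apply: (le_trans (le_normr_Rintegral measurableT intfg)).
have mAC : measurable (~` A) by exact: measurableC.
have M0 : S -> 0 <= M by move=> x; rewrite (le_trans _ (fM x)).
have int1 := integrable_indic mu (measurableC mA).
have inte := finite_measure_integrable_cst mu e measurableT.
have int2 : mu.-integrable setT (EFin \o (fun x => 2 * M * \1_(~` A) x)).
  exact: integrable_scale.
rewrite -(Rintegral_indic mAC) -RintegralZl//.
have -> : e = \int[mu]_(_ in setT) e by rewrite Rintegral_cst1.
rewrite -RintegralD//; apply: le_Rintegral => //.
- apply: (@integrable_bounded _ (M + M)); last by move=> x; rewrite normr_id; exact: fgM.
  exact: measurableT_comp.
- exact: (integrableD measurableT inte int2).
- move=> x _; rewrite indicE; have [xA|xA] := boolP (x \in A).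
    rewrite memNset; last by move/(_ (set_mem xA)).
    by rewrite mulr0 addr0; apply: fge; exact/set_mem.
  rewrite mem_set; last by move=> Ax; move/negP: xA; apply; exact/mem_set.
  rewrite mulr1 mulr_natl mulr2n (le_trans (fgM x))// lerDr//.
Qed.

End bounded_functions.

(** * Functions of finitely many symbols *)

Section finitely_determined_functions.
Context (m : nat).
Implicit Types (xi eta : sequences m) (j : symbol m).

Definition scons j xi : sequences m := fun n => if n is n'.+1 then xi n' else j.

(** The codomain is arbitrary, so as to cover sets and points of X. *)
Definition determined (n : nat) (U : Type) (g : sequences m -> U) :=
  forall xi eta, (forall i, (i < n)%N -> eta i = xi i) -> g eta = g xi.

(** A word stands for the cylinder it defines; the sequence is completed by an
arbitrary symbol, which functions determined by the word ignore. *)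
Definition of_word (s : seq (symbol m)) : sequences m := nth ord0 s.

Lemma of_word_cons j s : of_word (j :: s) = scons j (of_word s).
Proof. by apply/funext => -[]. Qed.

(** Sums over words are split at the first symbol, because the inverse measure
evolves by prepending symbols. *)
Lemma big_word_cons (V : nmodType) n (F : seq (symbol m) -> V) :
  \sum_(t : n.+1.-tuple (symbol m)) F t =
  \sum_(t : n.-tuple (symbol m)) \sum_(j : symbol m) F (j :: t).
Proof.
rewrite pair_big/= (reindex (fun q : n.-tuple (symbol m) * symbol m =>
  [tuple of q.2 :: q.1]))//=.
exists (fun t : n.+1.-tuple (symbol m) => ([tuple of behead t], thead t)).
  by move=> [t j] _; congr pair; apply/val_inj.
by move=> t _; rewrite [RHS]tuple_eta; apply/val_inj.
Qed.

Lemma measurable_determined n (A : set (borel (sequences m))) :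
  determined n.+1 A -> measurable A.
Proof.
move=> dA; apply: measurable_open; apply: (@open_cylinder_determined _ n).
by move=> xi eta h; rewrite (dA _ _ h).
Qed.

Lemma measurable_fun_determined d (U : measurableType d) n
    (g : borel (sequences m) -> U) :
  determined n.+1 g -> measurable_fun setT g.
Proof.
move=> dg _ Y mY; rewrite setTI; apply: (@measurable_determined n).
by move=> xi eta h; rewrite /preimage /= (dg _ _ h).
Qed.

Lemma determined_cylinder (a : nat -> symbol m) l :
  determined l.+1 (cylinder a l).
Proof.
by move=> xi eta h; apply/propext; split => H i il;
  [rewrite -h//; exact: H|rewrite h//; exact: H].
Qed.

Lemma measurable_cylinder (a : nat -> symbol m) l :
  measurable (cylinder a l : set (borel (sequences m))).
Proof. exact: measurable_determined (@determined_cylinder a l). Qed.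

(** The cylinders of a given length form a finite partition, so a function of
finitely many symbols is a simple function. *)
Lemma determined_sum_word (R : pzRingType) n (G : sequences m -> R) xi :
  determined n.+1 G ->
  G xi = \sum_(t : n.+1.-tuple (symbol m))
    G (of_word t) * \1_(cylinder (of_word t) n) xi.
Proof.
move=> dG.
(* the only word whose cylinder contains xi *)
pose t0 : n.+1.-tuple (symbol m) := [tuple xi (val i) | i < n.+1].
have t0E i : (i < n.+1)%N -> of_word t0 i = xi i.
  by move=> ni; rewrite /of_word (nth_map ord0) ?size_enum_ord//= nth_enum_ord.
rewrite (bigD1 t0)//= big1 => [|t tt0]; last first.
  rewrite indicE memNset ?mulr0// => xit; move/eqP: tt0; apply.
  apply/val_inj/(@eq_from_nth _ ord0); first by rewrite !size_tuple.
  move=> i; rewrite size_tuple => ni.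
  by rewrite -[RHS]/(of_word t0 i) t0E//; exact: esym (xit i ni).
rewrite addr0 indicE mem_set ?mulr1; last by move=> i ni; rewrite t0E.
by apply: dG => i ni; exact: esym (t0E i ni).
Qed.

Context (R : realType) (mu : probability (borel (sequences m)) R).

Lemma Rintegral_determined n (G : sequences m -> R)
    (A : set (borel (sequences m))) : determined n.+1 G -> measurable A ->
  \int[mu]_xi (\1_A xi * G xi) = \sum_(t : n.+1.-tuple (symbol m))
    G (of_word t) * fine (mu (cylinder (of_word t) n `&` A)).
Proof.
move=> dG mA.
pose I (t : n.+1.-tuple (symbol m)) :=
  \1_(cylinder (of_word t) n `&` A : set (borel (sequences m))) : _ -> R.
have mCA (t : n.+1.-tuple (symbol m)) :
    measurable (cylinder (of_word t) n `&` A : set (borel (sequences m))).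
  exact: measurableI (measurable_cylinder _ _) mA.
have intI t : mu.-integrable setT (EFin \o I t).
  exact: integrable_indic (mCA t).
transitivity (\int[mu]_xi \sum_(t : n.+1.-tuple (symbol m))
    G (of_word t) * I t xi).
  apply: eq_Rintegral => xi _; rewrite (determined_sum_word xi dG) mulr_sumr.
  by apply: eq_bigr => t _; rewrite /I indicI mulrC -mulrA.
rewrite Rintegral_sum => [|t].
  by apply: eq_bigr => t _; rewrite RintegralZl// Rintegral_indic.
exact: integrable_scale.
Qed.

Lemma Rintegral_determinedT n (G : sequences m -> R) : determined n.+1 G ->
  \int[mu]_xi G xi = \sum_(t : n.+1.-tuple (symbol m))
    G (of_word t) * fine (mu (cylinder (of_word t) n)).
Proof.
move=> dG; under eq_bigr do rewrite -[X in mu X]setIT.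
rewrite -Rintegral_determined//; apply: eq_Rintegral => xi _.
by rewrite indicE in_setT mul1r.
Qed.

End finitely_determined_functions.

(** * The transfer operator and the reversed chain *)

Section transfer_operator.
Context (R : realType) (X : pmetricType R) (m : nat).
Context (P : 'M[R]_m.+1) (T : symbol m -> continuousType X X).

(** The operator on functions that is dual to the Markov operator. *)
Definition transfer (f : X * symbol m -> R) (z : X * symbol m) : R :=
  \sum_(j : symbol m) P z.2 j * f (T j z.1, j).

(** T_{xi_0} o ... o T_{xi_{n-1}}: [comp_maps] composes n + 1 maps, whereas the
iteration formula starts from the empty composition. *)
Definition first_maps (xi : sequences m) (n : nat) (x : X) : X :=
  if n is n'.+1 then comp_maps T xi n' x else x.

(** Prepending a symbol applies a map last; this is why the reversed words are
the ones that the coding map reads. *)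
Lemma first_maps_scons j xi n x :
  first_maps (scons j xi) n.+1 x = T j (first_maps xi n x).
Proof.
case: n => [|n] //=; elim: n x => [|n ih] x //.
by rewrite -[RHS]ih.
Qed.

Lemma determined_first_maps n x : determined n (fun xi => first_maps xi n x).
Proof.
by case: n => [|n] xi eta h //=; rewrite (comp_maps_eq T h).
Qed.

(** The inverse measure in recursive form: a new first symbol j in front of a_0 is
a last step of the forward chain, from a_0 to j, hence the forward transition
probability. A usual Markov formula for the reversed chain would divide by p. *)
Definition reversed_chain (p : 'rV[R]_m.+1)
    (Q : probability (borel (sequences m)) R) :=
  (forall a, Q (cylinder a 0) = (p ord0 (a 0%N))%:E) /\
  (forall a l j,
    Q (cylinder (scons j a) l.+1) = ((P (a 0%N) j)%:E * Q (cylinder a l))%E).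

(** In the product for the reversed word, the last factor is the transition from
a_0 to j, and the others form the product for the shorter word. *)
Lemma inverse_measure_reversed_chain p (mu nu : probability (borel (sequences m)) R) :
  markov_measure P p mu -> inverse_measure mu nu -> reversed_chain p nu.
Proof.
move=> hmu hnu; split => [a|a l j]; rewrite !hnu !hmu.
  by rewrite big_ord0 mulr1.
rewrite -EFinM subn0/= subn0; congr EFin.
rewrite mulrCA; congr (_ * _); rewrite big_ord_recr/= mulrC; congr (_ * _).
  by rewrite subSn// !subnn.
apply: eq_bigr => -[i il] _ /=.
by rewrite subSn ?(ltnW il)// subSS /= -subSS subSn.
Qed.

Context (p : 'rV[R]_m.+1) (Q : probability (borel (sequences m)) R).
Hypothesis hQ : reversed_chain p Q.

(** Invariance of Q under prepending a random symbol. It holds word by word, by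
the defining property of the reversed chain. *)
Lemma Rintegral_scons n (G : sequences m -> R) : determined n.+2 G ->
  \int[Q]_xi G xi =
  \int[Q]_xi (\sum_(j : symbol m) P (xi 0%N) j * G (scons j xi)).
Proof.
move=> dG; rewrite (Rintegral_determinedT Q dG).
rewrite (big_word_cons _ (fun t => G (of_word t) * fine (Q (cylinder (of_word t) n.+1)))).
rewrite (@Rintegral_determinedT _ _ Q n) => [|xi eta h].
  apply: eq_bigr => t _; rewrite mulr_suml; apply: eq_bigr => j _.
  rewrite of_word_cons hQ.2 fineM//; last exact: fin_num_measure (measurable_cylinder _ _).
  by rewrite /= mulrCA mulrA.
apply: eq_bigr => j _; rewrite h//; congr (_ * _); apply: dG => -[|i] //= ni.
exact: h.
Qed.

(** Path formula. The induction step is [Rintegral_scons]: prepending j to xi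
turns the constraint xi_(n+1) = i into xi_n = i, and produces the extra map T_j
that the transfer operator applies. *)
Lemma iter_transferE n f x i :
  p ord0 i * iter n transfer f (x, i) =
  \int[Q]_xi ((xi n == i)%:R * f (first_maps xi n x, xi 0%N)).
Proof.
elim: n f => [|n ih] f.
  pose C := cylinder (fun=> i) 0 : set (borel (sequences m)).
  have mC : measurable C by exact: measurable_cylinder.
  transitivity (\int[Q]_xi (f (x, i) * \1_C xi)).
    rewrite RintegralZl//; last exact: integrable_indic.
    by rewrite Rintegral_indic// hQ.1/= mulrC.
  apply: eq_Rintegral => xi _; rewrite indicE mulrC.
  have [xii|xii] := eqVneq (xi 0%N) i.
    by rewrite mem_set ?xii// => k; rewrite leqn0 => /eqP ->.
  rewrite memNset ?mul0r// => /(_ 0%N (leqnn _)) h.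
  by rewrite h eqxx in xii.
rewrite iterSr ih [RHS](@Rintegral_scons n) => [|xi eta h]; last first.
  rewrite /= (h n.+1)// (h 0%N)//; congr (_ * f (_, _)).
  by apply: (@determined_first_maps n.+1 x) => k kn; apply: h; exact: ltnW.
apply: eq_Rintegral => xi _; rewrite /transfer/= mulr_sumr.
by apply: eq_bigr => j _; rewrite -first_maps_scons mulrCA.
Qed.

End transfer_operator.

(** * Continuous functions on a compact phase space *)

Section continuous_on_compact.
Context (R : realType) (X : pmetricType R) (cptX : compact [set: X]) (m : nat).
Context (f : X * symbol m -> R) (cf : continuous f).

Lemma compact_product : compact [set: X * symbol m].
Proof.
have cptA : compact [set: symbol m] by apply: finite_compact; exact: finite_finset.
by rewrite -setXTT; exact: compact_setX.
Qed.

Lemma continuous_bounded : exists2 M, 0 <= M & forall z, `|f z| <= M.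
Proof.
have : compact [set f z | z in [set: X * symbol m]].
  by apply: continuous_compact compact_product; exact: continuous_subspaceT.
move=> /compact_bounded [M [_ hM]]; exists (`|M| + 1) => [|z].
  by rewrite addr_ge0.
apply: (hM (`|M| + 1)); last by exists z.
by rewrite (le_lt_trans (ler_norm M))// ltrDl.
Qed.

(** Only the first coordinate moves, as the symbol of a coded point is known
exactly. The proof is a Lebesgue number argument: near each point z a radius r
works for all points close to z, and compactness makes r uniform. *)
Lemma uniformly_continuous (e : R) : 0 < e -> exists2 r, 0 < r &
  forall (x y : X) j, mdist x y < r -> `|f (x, j) - f (y, j)| <= e.
Proof.
move=> e0.
have /compact_near_coveringP cov := compact_product.
have : \forall r \near 0^'+, [set: X * symbol m] `<=`
    [set z | forall y, mdist z.1 y < r -> `|f z - f (y, z.2)| <= e].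
  apply: cov => z _.
  have e20 : 0 < e / 2 by rewrite divr_gt0.
  have : \forall w \near z, `|f z - f w| < e / 2.
    by have /cvgrPdist_lt := @cf z; exact.
  move=> /nbhs_ballP [d /= d0 hd].
  have d20 : 0 < d / 2 by rewrite divr_gt0.
  exists (ball z (d / 2), [set r | r < d / 2]).
    by split; [exact: nbhsx_ballx|exact: nbhs_right_lt].
  move=> [w r] /= [[zw1 zw2] rd] y wy.
  have d2d : d / 2 <= d by lra.
  have wz : ball z d w by split; [exact: le_ball zw1|exact: le_ball zw2].
  have yz : ball z d (y, w.2).
    split => /=; last exact: le_ball zw2.
    rewrite [d]splitr; apply: ball_triangle zw1 _.
    by rewrite ballEmdist /= (lt_trans wy).
  have := hd _ wz; have := hd _ yz => /= h1 h2.
  rewrite (splitr e) (le_trans (ler_distD (f z) _ _))// lerD//.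
    by rewrite distrC ltW.
  exact: ltW.
move=> h; near (0 : R)^'+ => r; exists r => // x y j xy.
by have /(_ (x, j) I y xy) : [set: X * symbol m] `<=`
    [set z | forall y, mdist z.1 y < r -> `|f z - f (y, z.2)| <= e] by near: r.
Unshelve. all: by end_near. Qed.

End continuous_on_compact.

(** * Uniform convergence of the iterated transfer operator *)

Section uniform_limit.
Context (R : realType) (X : pmetricType R) (cptX : compact [set: X]) (m : nat).
Context (P : 'M[R]_m.+1) (T : symbol m -> continuousType X X).
Context (p : 'rV[R]_m.+1) (Q : probability (borel (sequences m)) R).
Hypotheses (hQ : reversed_chain P p Q) (mixQ : mixing Q).
Hypothesis (Qwh : Q (weakly_hyperbolic T) = 1%E).

(** The set of sequences on which all compositions from rank N on, and the coding
map, are known up to r. Keeping weak hyperbolicity in the definition makes the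
union over N exactly the set of weakly hyperbolic sequences. *)
Definition contracted (r : R) (N : nat) : set (borel (sequences m)) :=
  weakly_hyperbolic T `&`
  [set xi | (diam (range (comp_maps T xi N)) < r%:E)%E].

Lemma measurable_contracted r N : measurable (contracted r N).
Proof.
apply: measurableI; first exact: measurable_weakly_hyperbolic.
by apply: (@measurable_determined m N) => xi eta h /=; rewrite (comp_maps_eq T h).
Qed.

Lemma range_comp_maps_sub xi N n : (N <= n)%N ->
  range (comp_maps T xi n) `<=` range (comp_maps T xi N).
Proof. by move=> Nn; rewrite -(subnKC Nn); exact: comp_maps_range. Qed.

Lemma mdist_contracted r N n xi x y : contracted r N xi -> (N <= n)%N ->
  mdist (comp_maps T xi n x) (comp_maps T xi N y) < r.
Proof.
move=> [_ xir] Nn; rewrite -lte_fin; apply: le_lt_trans xir.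
apply: mdist_diam; last by exists y.
by apply: (range_comp_maps_sub Nn); exists x.
Qed.

(** The sets increase with N, because the ranges of the compositions decrease, and
their union has full measure. *)
Lemma contracted_eventually (r e : R) : 0 < r -> 0 < e ->
  exists N, fine (Q (~` contracted r N)) <= e.
Proof.
move=> r0 e0.
have bigE : \bigcup_N contracted r N = weakly_hyperbolic T.
  apply/seteqP; split => [xi [N _ []]//|xi hxi].
  have [N _ hN] := weakly_hyperbolic_lt hxi r0.
  by exists N => //; split => //; exact: (hN N (leqnn N)).
have nd : nondecreasing_seq (contracted r).
  move=> a b ab; apply/subsetPset => xi [hxi xir]; split => //=.
  apply: le_lt_trans xir; apply: le_ereal_sup => _ [x hx [y hy <-]].
  exists x; first exact: (range_comp_maps_sub ab).
  by exists y => //; exact: (range_comp_maps_sub ab).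
have : Q (contracted r N) @[N --> \oo] --> Q (weakly_hyperbolic T).
  rewrite -bigE; apply: nondecreasing_cvg_mu => //.
    exact: measurable_contracted.
  by rewrite bigE; exact: measurable_weakly_hyperbolic.
rewrite Qwh => /fine_cvgP [_ /cvgrPdist_le /(_ _ e0) [N _ hN]].
exists N; rewrite probability_setC; last exact: measurable_contracted.
rewrite fineB//; last exact: fin_num_measure (measurable_contracted r N).
exact: le_trans (ler_norm _) (hN N (leqnn _)).
Qed.

Lemma reversed_chain_ge0 i : 0 <= p ord0 i.
Proof. by rewrite -lee_fin -(hQ.1 (fun=> i)) measure_ge0. Qed.

Lemma reversed_chain_le1 i : p ord0 i <= 1.
Proof.
rewrite -lee_fin -(hQ.1 (fun=> i)); apply: probability_le1.
exact: measurable_cylinder.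
Qed.

(** Mixing for a cylinder of length one against a function of finitely many
symbols, which is a finite combination of indicators of cylinders. *)
Lemma mixing_determined n (G : sequences m -> R) i : determined n.+1 G ->
  \int[Q]_xi ((xi l == i)%:R * G xi) @[l --> \oo] -->
  p ord0 i * \int[Q]_xi G xi.
Proof.
move=> dG; pose C := cylinder (fun=> i) 0 : set (borel (sequences m)).
have mC : measurable C by exact: measurable_cylinder.
have iterE l (xi : sequences m) : iter l (@Defs.shift m) xi 0%N = xi l.
  by elim: l xi => // l ih xi; rewrite iterSr ih.
have CE l : iter l (@Defs.shift m) @^-1` C = [set xi : sequences m | xi l = i].
  apply/seteqP; split => xi /=; first by move=> /(_ 0%N (leqnn _)); rewrite iterE.
  by move=> xil k; rewrite leqn0 => /eqP ->; rewrite iterE.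
have mCl l : measurable (iter l (@Defs.shift m) @^-1` C : set (borel (sequences m))).
  rewrite CE; apply: (@measurable_determined m l) => xi eta h.
  by rewrite /mkset /= (h l).
have -> : (fun l => \int[Q]_xi ((xi l == i)%:R * G xi)) = (fun l =>
    \sum_(t : n.+1.-tuple (symbol m)) G (of_word t) *
      fine (Q ((iter l (@Defs.shift m) @^-1` C) `&` cylinder (of_word t) n))).
  apply/funext => l.
  transitivity (\int[Q]_xi (\1_(iter l (@Defs.shift m) @^-1` C) xi * G xi)).
    apply: eq_Rintegral => xi _; congr (_ * _).
    rewrite CE indicE; case: eqVneq => [xil|xil]; first by rewrite mem_set.
    by rewrite memNset//= => h; rewrite h eqxx in xil.
  rewrite (Rintegral_determined Q dG (mCl l)).
  by apply: eq_bigr => t _; rewrite setIC.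
rewrite (Rintegral_determinedT Q dG) mulr_sumr.
apply: (cvg_big add_continuous) => t _; rewrite mulrCA; apply: cvgMl_tmp.
have mt := measurable_cylinder (of_word t) n.
have := mixQ mC mt.
have -> : (Q C * Q (cylinder (of_word t) n))%E =
    (p ord0 i * fine (Q (cylinder (of_word t) n)))%:E.
  by rewrite EFinM fineK ?hQ.1//; exact: fin_num_measure.
by move=> /fine_cvgP [].
Qed.

Context (f : X * symbol m -> R) (cf : continuous f).

(** [g n x] approximates [phi], which is f at the coded point. Extending phi by 0
off the weakly hyperbolic set makes it measurable everywhere. *)
Let g n x (xi : sequences m) := f (comp_maps T xi n x, xi 0%N).

Let phi := (fun xi => f (gcoding T xi)) \_ (weakly_hyperbolic T).

Let determined_g n x : determined n.+1 (g n x).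
Proof. by move=> xi eta h; rewrite /g (comp_maps_eq T h) (h 0%N). Qed.

Let measurable_phi : measurable_fun setT (phi : borel (sequences m) -> R).
Proof.
apply/(measurable_restrictT _ (measurable_weakly_hyperbolic T)).
apply: (@measurableT_comp _ _ _ _ _ _ (f : borel (X * symbol m)%type -> R)).
  exact: measurable_continuous_real.
exact: measurable_gcoding.
Qed.

Let bounded_phi (M : R) : (forall z, `|f z| <= M) -> forall xi, `|phi xi| <= M.
Proof.
move=> fM xi; rewrite /phi patchE; case: ifP => _; first exact: fM.
by rewrite normr0 (le_trans _ (fM (point, ord0))).
Qed.

Let dist_g_phi (r e : R) N xi x : contracted r N xi ->
  (forall (x y : X) j, mdist x y < r -> `|f (x, j) - f (y, j)| <= e) ->
  `|phi xi - g N x xi| <= e.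
Proof.
move=> cxi hf; have [hxi _] := cxi.
rewrite /phi patchE mem_set//.
have cvg_g : g n point xi @[n --> \oo] --> f (gcoding T xi).
  apply: (@cvg_comp _ _ _ (fun n => (comp_maps T xi n point, xi 0%N)) f _ _ _ _ (@cf _)).
  exact: (cvg_pair (coding_cvg cptX hxi) (cvg_cst _)).
apply: (cvgr_to_le (cvg_norm (cvgB cvg_g (cvg_cst (g N x xi))))).
exists N => // n Nn; apply: hf; exact: mdist_contracted cxi Nn.
Qed.

(** With n > N, three comparisons: from [g n x] to [g N point] under the constraint
xi_n = i (contraction), removal of the constraint for the fixed function
[g N point] (mixing), and from [g N point] to phi (contraction again). All
three are uniform in x and i. *)
Lemma iter_transfer_cvg (e : R) : 0 < e -> \forall n \near \oo, forall x i,
  `|p ord0 i * iter n (transfer P T) f (x, i) -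
    p ord0 i * \int[Q]_(xi in weakly_hyperbolic T) f (gcoding T xi)| <= e.
Proof.
move=> e0; rewrite Rintegral_mkcond -/phi.
have [M M0 fM] := continuous_bounded cptX cf.
(* Each contraction step costs e1 + 2 M s <= 2 e1 and mixing costs e1, in total
   5 e1; the + 1 keeps the denominator positive when M = 0. *)
pose e1 := e / 6; pose s := e1 / (2 * M + 1).
have e10 : 0 < e1 by rewrite divr_gt0.
have s0 : 0 < s by rewrite divr_gt0// ltr_wpDl// mulr_ge0.
have sM : 2 * M * s <= e1.
  have : s * (2 * M + 1) = e1 by rewrite /s mulfVK// gt_eqF// ltr_wpDl// mulr_ge0.
  by lra.
have [r r0 hr] := uniformly_continuous cptX cf e10.
have [N QN] := contracted_eventually r0 s0.
have err : e1 + 2 * M * fine (Q (~` contracted r N)) <= 2 * e1.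
  have : 2 * M * fine (Q (~` contracted r N)) <= 2 * M * s.
    by rewrite ler_wpM2l// mulr_ge0.
  by lra.
have mC := measurable_contracted r N.
have mix : \forall n \near \oo, forall i : symbol m,
    `|\int[Q]_xi ((xi n == i)%:R * g N point xi) -
      p ord0 i * \int[Q]_xi g N point xi| <= e1.
  apply: filter_forall => i.
  have /cvgrPdist_le := mixing_determined (i := i) (@determined_g N point).
  by move=> /(_ _ e10); apply: filterS => n; rewrite distrC.
have [K _ hK] := mix.
exists (maxn K N.+1) => // n /=; rewrite geq_max => /andP[Kn].
case: n Kn => // n Kn Nn x i; rewrite (iter_transferE T hQ)/=.
have ind_le (y : R) (xi : sequences m) : `|y| <= M ->
    `|(xi n.+1 == i)%:R * y| <= M.
  by case: eqVneq => _; rewrite ?mul1r// mul0r normr0.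
have meas_ind (l : nat) y : (l <= n)%N -> measurable_fun setT
    ((fun xi => (xi n.+1 == i)%:R * g l y xi) : borel (sequences m) -> R).
  move=> ln; apply: (@measurable_fun_determined _ _ _ n.+1) => xi eta h /=.
  rewrite (h n.+1)//; congr (_ * _); apply: (@determined_g l y) => k kl.
  by apply: h; rewrite (leq_trans kl)// ltnW.
have A1 : `|\int[Q]_xi ((xi n.+1 == i)%:R * g n x xi) -
    \int[Q]_xi ((xi n.+1 == i)%:R * g N point xi)| <= 2 * e1.
  apply: le_trans err; apply: dist_Rintegral => //.
  - exact: meas_ind.
  - exact: meas_ind.
  - by move=> xi; apply: ind_le; exact: fM.
  - by move=> xi; apply: ind_le; exact: fM.
  - exact: ltW.
  - move=> xi cxi; rewrite -mulrBr; case: eqVneq => _; last by rewrite mul0r normr0 ltW.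
    by rewrite mul1r; apply: hr; exact: (mdist_contracted _ _ cxi).
have A2 : `|\int[Q]_xi ((xi n.+1 == i)%:R * g N point xi) -
    p ord0 i * \int[Q]_xi g N point xi| <= e1 by exact: hK.
have A3 : `|p ord0 i * \int[Q]_xi g N point xi - p ord0 i * \int[Q]_xi phi xi| <= 2 * e1.
  rewrite -mulrBr normrM (ger0_norm (reversed_chain_ge0 i)).
  apply: le_trans (ler_piMl (normr_ge0 _) (reversed_chain_le1 i)) _.
  apply: le_trans err; apply: dist_Rintegral => //.
  - exact: (measurable_fun_determined (@determined_g N point)).
  - by move=> xi; exact: fM.
  - exact: bounded_phi.
  - exact: ltW.
  - by move=> xi cxi; rewrite distrC; exact: dist_g_phi cxi hr.
have e16 : 6 * e1 = e by rewrite /e1 mulrC mulfVK.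
apply: le_trans (ler_distD (\int[Q]_xi ((xi n.+1 == i)%:R * g N point xi)) _ _) _.
apply: le_trans (lerD A1 (ler_distD (p ord0 i * \int[Q]_xi g N point xi) _ _)) _.
by have := lerD A2 A3; lra.
Qed.

End uniform_limit.

(** * Duality between the Markov and transfer operators *)

Section duality.
Context (R : realType) (X : pmetricType R) (cptX : compact [set: X]) (m : nat).
Context (P : transition_matrix R m) (T : symbol m -> continuousType X X).

Let Y : ptopologicalType := (X * symbol m)%type.

Lemma continuous_branch j :
  continuous ((fun z => (T j z.1, j)) : X * symbol m -> X * symbol m).
Proof.
move=> z; have Tc : {for z, continuous (fun w : X * symbol m => T j w.1)}.
  by apply: continuous_comp; [exact: cvg_fst | exact: cts_fun].
exact: (cvg_pair Tc (cvg_cst j)).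
Qed.

Lemma continuous_transfer (f : X * symbol m -> R) :
  continuous f -> continuous (transfer P T f).
Proof.
move=> cf z; rewrite /transfer; apply: (cvg_big add_continuous) => j _.
apply: cvgM.
  apply: (@cvg_comp _ _ _ snd (fun i : symbol m => P i j)); first exact: cvg_snd.
  have : continuous (fun i : symbol m => P i j : R).
    by apply/continuousP => A _; exact: discrete_open.
  exact.
exact: (cvg_comp _ _ (@continuous_branch j z) (@cf (T j z.1, j))).
Qed.

Lemma measurable_branch j : measurable_fun setT
  ((fun z => (T j z.1, j)) : borel Y -> borel Y).
Proof.
exact: (@measurable_continuous Y Y _ (@continuous_branch j)).
Qed.

Lemma measurable_snd_eq (i : symbol m) :
  measurable ([set z | z.2 = i] : set (borel Y)).
Proof.
apply: measurable_open; have /continuousP cs : continuous (@snd X (symbol m)).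
  by move=> z; exact: cvg_snd.
by apply: (cs [set i]); exact: discrete_open.
Qed.

Context (mu : probability (borel Y) R).

(** The (i, j) term of the Markov operator as a measure, so that its integrals can
be computed by the rules for sums, multiples, images and restrictions. *)
Let piece (i j : symbol m) : {measure set (borel Y) -> \bar R} :=
  mscale (NngNum (transition_ge0 P i j))
    (measure_function_pushforward__canonical__measure_function_Measure
      (mrestr mu (measurable_snd_eq i)) (measurable_branch j)).

Let row (i : symbol m) : {measure set (borel Y) -> \bar R} :=
  msum (fun j : nat => piece i (inord j)) m.+1.

Let markov_operator_msum B : measurable B ->
  markov_operator P T mu B = msum (fun i : nat => row (inord i)) m.+1 B.
Proof.
move=> mB; rewrite markov_operatorE /markov_fun /msum/=.
apply: eq_bigr => i _; rewrite inord_val /row /msum/=.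
by apply: eq_bigr => j _; rewrite inord_val /piece /mscale/=; congr (_ * _)%E.
Qed.

Let ge0_integral_piece i j (f : borel Y -> \bar R) :
  measurable_fun setT f -> (forall z, 0 <= f z)%E ->
  (\int[piece i j]_z f z =
   (P i j)%:E * \int[mu]_(z in [set z | z.2 = i]) f (T j z.1, j))%E.
Proof.
move=> mf f0; rewrite ge0_integral_mscale//; congr (_ * _)%E.
rewrite (ge0_integral_pushforward (measurable_branch j))//.
rewrite preimage_setT ge0_integral_mrestr//; last by move=> z; exact: f0.
exact: measurableT_comp mf (measurable_branch j).
Qed.

Lemma ge0_integral_markov_operator (f : borel Y -> \bar R) :
  measurable_fun setT f -> (forall z, 0 <= f z)%E ->
  (\int[markov_operator P T mu]_z f z =
   \int[mu]_z \sum_(j : symbol m) (P z.2 j)%:E * f (T j z.1, j))%E.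
Proof.
move=> mf f0.
have mfj j : measurable_fun setT (fun z : borel Y => f (T j z.1, j)).
  exact: measurableT_comp mf (measurable_branch j).
rewrite (eq_measure_integral (msum (fun i : nat => row (inord i)) m.+1)); last first.
  by move=> B mB _; exact: markov_operator_msum.
rewrite ge0_integral_measure_sum//.
have m1 i : measurable_fun setT
    (fun z : borel Y => (\1_[set z : Y | z.2 = i] z)%:E : \bar R).
  by apply/measurable_EFinP; exact: measurable_indic (measurable_snd_eq i).
transitivity (\sum_(i : symbol m) \sum_(j : symbol m)
  \int[mu]_z ((P i j)%:E * f (T j z.1, j) * (\1_[set z : Y | z.2 = i] z)%:E))%E.
  apply: eq_bigr => i _; rewrite inord_val ge0_integral_measure_sum//.
  apply: eq_bigr => j _; rewrite inord_val ge0_integral_piece//.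
  rewrite integral_mkcond -ge0_integralZl//; last 3 first.
  - apply/(measurable_restrictT _ (measurable_snd_eq i)).
    exact: measurable_funTS.
  - by move=> z _; rewrite patchE; case: ifP.
  - by rewrite lee_fin transition_ge0.
  apply: eq_integral => z _; rewrite patchE indicE.
  by case: ifP => _; rewrite ?mule1// !mule0.
have P0 i j z : (0 <= (P i j)%:E * f (T j z.1, j))%E.
  by rewrite mule_ge0// lee_fin transition_ge0.
have mP i j : measurable_fun setT (fun z : borel Y => (P i j)%:E * f (T j z.1, j))%E.
  by apply: emeasurable_funM.
have P1 i j z : (0 <= (P i j)%:E * f (T j z.1, j) * (\1_[set z : Y | z.2 = i] z)%:E)%E.
  by rewrite mule_ge0// lee_fin indicE.
have mP1 i j : measurable_fun setT (fun z : borel Y =>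
    (P i j)%:E * f (T j z.1, j) * (\1_[set z : Y | z.2 = i] z)%:E)%E.
  by apply: emeasurable_funM.
under eq_bigr do rewrite -ge0_integral_sum//.
rewrite -ge0_integral_sum//; last 2 first.
- by move=> i; apply: emeasurable_sum => j.
- by move=> i z _; apply: sume_ge0.
apply: eq_integral => z _; rewrite exchange_big/=; apply: eq_bigr => j _.
(* only the term i = z.2 survives in the sum over the source symbols *)
rewrite (bigD1 (z.2 : symbol m))//= indicE mem_set// mule1 big1 ?adde0// => i iz.
by rewrite indicE memNset ?mule0//= => zi; rewrite -zi eqxx in iz.
Qed.

(** As the rows of P sum to 1, both sides shift by M when f is replaced by f + M;
with M a bound of |f|, this reduces to nonnegative functions. *)
Lemma Rintegral_markov_operator (f : X * symbol m -> R) : continuous f ->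
  \int[markov_operator P T mu]_z f z = \int[mu]_z transfer P T f z.
Proof.
move=> cf; have [M M0 fM] := continuous_bounded cptX cf.
have transferM z : `|transfer P T f z| <= M.
  rewrite /transfer (le_trans (ler_norm_sum _ _ _))//.
  apply: (@le_trans _ _ (\sum_(j : symbol m) P z.2 j * M)).
    apply: ler_sum => j _; rewrite normrM ger0_norm ?transition_ge0//.
    by rewrite ler_wpM2l ?transition_ge0.
  by rewrite -mulr_suml (transition_sum1 P) mul1r.
have mf := @measurable_continuous_real _ Y _ cf.
have mLf := @measurable_continuous_real _ Y _ (continuous_transfer cf).
have intf := integrable_bounded (markov_operator P T mu) mf fM.
have intLf := integrable_bounded mu mLf transferM.
have icst (nu : probability (borel Y) R) := finite_measure_integrable_cst nu M measurableT.
suff : \int[markov_operator P T mu]_z (f z + M) =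
    \int[mu]_z (transfer P T f z + M).
  rewrite (RintegralD measurableT intf (icst _)) (RintegralD measurableT intLf (icst _)).
  by rewrite (Rintegral_cst1 mu) (Rintegral_cst1 (markov_operator P T mu)) => /addIr.
rewrite /Rintegral ge0_integral_markov_operator; last 2 first.
- by apply/measurable_EFinP; exact: measurable_funD.
- by move=> z; rewrite lee_fin -lerBlDr sub0r; have := fM z; rewrite ler_norml => /andP[].
congr fine; apply: eq_integral => z _.
under eq_bigr do rewrite -EFinM mulrDr.
rewrite sumEFin big_split/= -mulr_suml.
by rewrite (transition_sum1 P) mul1r.
Qed.

End duality.

(** * Probability measures are determined by integrals of continuous functions *)

Section measures_determined_by_continuous_functions.
Context (R : realType) (Y : pseudoPMetricType R).

(** The distance to A may be infinite, for instance when A is empty; its contraction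
is a continuous function with values in [0, 1] that vanishes, for closed A,
exactly on A. *)
Definition gap (A : set Y) (y : Y) : R := contract (edist_inf A y).

(** The distance on the extended reals is by definition the one that makes
[contract] an isometry. *)
Lemma contract_continuous : continuous (@contract R).
Proof.
move=> x; apply/cvgrPdist_lt => e e0.
by have : nbhs x (ball x e) by exact: nbhsx_ballx.
Qed.

Lemma gap_continuous A : continuous (gap A).
Proof.
move=> y; apply: continuous_comp; first exact: edist_inf_continuous.
exact: contract_continuous.
Qed.

Lemma gap_ge0 A y : 0 <= gap A y.
Proof. by rewrite /gap -contract0 le_contract edist_inf_ge0. Qed.

Lemma gap_le1 A y : gap A y <= 1.
Proof. by rewrite (le_trans (ler_norm _))// contract_le1. Qed.

Lemma gap0 (A : set Y) y : A y -> gap A y = 0.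
Proof. by move=> Ay; rewrite /gap edist_inf0// contract0. Qed.

Lemma gap_gt0 (A : set Y) y : closed A -> ~ A y -> 0 < gap A y.
Proof.
move=> cA nAy; have : open (~` A) by exact: closed_openC.
rewrite openE => /(_ _ nAy) /nbhs_ballP [r /= r0 rA].
rewrite /gap -contract0 lt_contract; apply: (@lt_le_trans _ _ r%:E).
  by rewrite lte_fin.
apply: le_ereal_inf_tmp => _ [a Aa <-]; rewrite leNgt; apply/negP => /edist_lt_ball.
by move=> /rA.
Qed.

(** For closed A, these continuous functions decrease to the indicator of A. *)
Let bump (A : set Y) (n : nat) (y : Y) : R := (1 - gap A y) ^+ n.

Lemma bump_continuous A n : continuous (bump A n).
Proof.
move=> y; apply: (@continuous_comp _ _ _ (fun y => 1 - gap A y) (fun r : R => r ^+ n)).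
  by apply: cvgB; [exact: cvg_cst|exact: gap_continuous].
exact: exprn_continuous.
Qed.

Lemma bump_cvg (A : set Y) y : closed A ->
  bump A n y @[n --> \oo] --> (\1_A y : R).
Proof.
move=> cA; rewrite indicE; have [yA|yA] := boolP (y \in A).
  rewrite /bump gap0 ?subr0; last exact/set_mem.
  by under eq_cvg do rewrite expr1n; exact: cvg_cst.
apply: cvg_expr; have := @gap_gt0 A y cA.
rewrite ger0_norm ?subr_ge0 ?gap_le1// gtrBl; apply.
by move=> Ay; move/negP: yA; apply; exact/mem_set.
Qed.

(** By dominated convergence along [bump], the measures agree on closed sets, hence
on open sets, which are stable under intersection and generate. *)
Lemma probability_eq_continuous (mu nu : probability (borel Y) R) :
  (forall f : Y -> R, continuous f -> \int[mu]_y f y = \int[nu]_y f y) ->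
  forall B : set (borel Y), measurable B -> mu B = nu B.
Proof.
move=> h.
have lim (m : probability (borel Y) R) (A : set Y) : closed A ->
    \int[m]_y bump A n y @[n --> \oo] --> fine (m A).
  move=> cA; have mA := @measurable_closed Y A cA.
  have bump_le1 n y : `|bump A n y| <= 1.
    rewrite normrX exprn_ile1// ger0_norm ?subr_ge0 ?gap_le1//.
    by rewrite gerBl gap_ge0.
  have := @dominated_convergence _ _ _ m setT measurableT
    (fun n y => (bump A n y)%:E) (fun y => (\1_A y)%:E) (cst 1%E).
  case.
  - move=> n; apply/measurable_EFinP.
    exact: measurable_continuous_real (@bump_continuous A n).
  - by apply/measurable_EFinP; exact: measurable_indic.
  - by apply: aeW => y _; apply: cvg_EFin; [exact: nearW|exact: bump_cvg].
  - exact: (finite_measure_integrable_cst m 1 measurableT).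
  - by apply: aeW => y n _; rewrite lee_fin.
  move=> _ _; rewrite integral_indic// setIT.
  by rewrite -[X in _ --> X -> _](@fineK _ (m A)) ?fin_num_measure// => /fine_cvgP[].
have eq_closed (A : set Y) : closed A -> mu A = nu A.
  move=> cA; have mA := @measurable_closed Y A cA.
  rewrite -(@fineK _ (mu A)) ?fin_num_measure// -(@fineK _ (nu A)) ?fin_num_measure//.
  have E : (fun n => \int[mu]_y bump A n y) = (fun n => \int[nu]_y bump A n y).
    by apply/funext => n; exact: h (@bump_continuous A n).
  have := lim nu A cA; rewrite -E => nuA; congr EFin.
  exact: (cvg_unique _ (lim mu A cA) nuA).
move=> B mB.
apply: (@measure_unique _ R (borel Y) (@open Y) (fun=> setT) _ _ _ _ mu nu) => //.
- exact: openI.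
- by move=> _; exact: openT.
- by rewrite bigcup_const//; exists 0%N.
- move=> U oU; have mU := measurable_open oU.
  have setCE (m : probability (borel Y) R) : m U = (1 - m (~` U))%E.
    by rewrite -{1}(setCK U); exact: probability_setC (measurableC mU).
  transitivity (1 - mu (~` U))%E; first exact: setCE.
  by rewrite eq_closed; [exact: esym (setCE nu)|exact: open_closedC].
- by move=> _; rewrite (le_lt_trans (probability_le1 mu measurableT))// ltry.
Qed.

End measures_determined_by_continuous_functions.

(** * The coding measure and the stationary vector *)

Section coding_measure.
Context (R : realType) (X : pmetricType R) (cptX : compact [set: X]) (m : nat).
Context (T : symbol m -> continuousType X X).
Context (Q : probability (borel (sequences m)) R).
Context (Qwh : Q (weakly_hyperbolic T) = 1%E).

Let Y : ptopologicalType := (X * symbol m)%type.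

(** The coding map made total; the arbitrary value off the weakly hyperbolic set
has no effect on integrals, as the complement is null. *)
Let tcoding : borel (sequences m) -> borel Y :=
  patch (fun=> point) (weakly_hyperbolic T) (gcoding T).

Let measurable_tcoding : measurable_fun setT tcoding.
Proof.
apply/(measurable_restrictT _ (measurable_weakly_hyperbolic T)).
exact: measurable_gcoding.
Qed.

Let Q_not_wh : Q (~` weakly_hyperbolic T) = 0%E.
Proof.
rewrite probability_setC; last exact: measurable_weakly_hyperbolic.
by rewrite Qwh subee.
Qed.

Lemma Rintegral_gcoding_pushforward (f : X * symbol m -> R) : continuous f ->
  \int[gcoding_pushforward cptX Qwh]_z f z =
  \int[Q]_(xi in weakly_hyperbolic T) f (gcoding T xi).
Proof.
move=> cf; have [M M0 fM] := continuous_bounded cptX cf.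
have mD := measurable_weakly_hyperbolic T.
have mf := @measurable_continuous_real _ Y _ cf.
have mft : measurable_fun setT (f \o tcoding) by exact: measurableT_comp.
have pushE B : measurable B -> gcoding_pushforward cptX Qwh B =
    measure_function_pushforward__canonical__measure_function_Measure
      Q measurable_tcoding B.
  move=> mB; rewrite gcoding_pushforwardE /gcoding_image /= /pushforward.
  have mtB : measurable (tcoding @^-1` B) by rewrite -[X in measurable X]setTI; exact: measurable_tcoding.
  transitivity (Q (tcoding @^-1` B `&` weakly_hyperbolic T)).
    rewrite setIC; congr (Q _); apply/seteqP.
    by split => xi [] /= h hxi; split => //; move: h; rewrite /tcoding patchE mem_set.
  exact: esym (measure_conull mtB mD Q_not_wh).
transitivity (\int[Q]_xi f (tcoding xi)).
  rewrite /Rintegral (eq_measure_integral _ (fun B mB _ => pushE B mB)).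
  congr fine; rewrite (integral_pushforward measurable_tcoding)//.
    exact/measurable_EFinP.
  exact: (integrable_bounded Q mft (fun xi => fM (tcoding xi))).
apply/eqP; rewrite -subr_eq0 -normr_le0 [X in _ - X]Rintegral_mkcond.
apply: (@le_trans _ _ (0 + 2 * M * fine (Q (~` weakly_hyperbolic T)))); last first.
  by rewrite Q_not_wh mulr0 addr0.
apply: dist_Rintegral => //.
- apply/(measurable_restrictT _ mD).
  apply: (@measurableT_comp _ _ _ _ _ _ (f : borel (X * symbol m)%type -> R)).
    exact: measurable_continuous_real.
  exact: measurable_gcoding.
- move=> xi; rewrite patchE; case: ifP => _; first exact: fM.
  by rewrite normr0.
- by move=> xi hxi; rewrite /tcoding !patchE mem_set// subrr normr0.
Qed.

End coding_measure.

(** From p = p P^n: p_i is at least p_l (P^n)_{l i} for some l with p_l > 0 and some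
n given by irreducibility. *)
Lemma stationary_vector_gt0 (R : realType) m (P : transition_matrix R m) p i :
  irreducible_mx P -> stationary_vector P p -> 0 < p ord0 i.
Proof.
move=> irr [p0 p1 pP].
have pPn n : p *m (P : 'M[R]_m.+1) ^+ n = p.
  elim: n => [|n ih]; first by rewrite expr0 mulmx1.
  by rewrite exprS -mulmxE mulmxA pP.
have Pn0 n l r : 0 <= ((P : 'M[R]_m.+1) ^+ n) l r.
  elim: n l r => [|n ih] l r; first by rewrite expr0 mxE ler0n.
  by rewrite exprS mxE sumr_ge0// => k _; rewrite mulr_ge0 ?transition_ge0.
have [l pl] : exists l : 'I_m.+1, p ord0 l != 0.
  apply/existsP; apply: contra_eqT p1; rewrite negb_exists => /forallP h.
  rewrite big1 => [|l _]; first by rewrite eq_sym oner_eq0.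
  by apply/eqP; have := h l; rewrite negbK.
have [n _ Pli] := irr l i.
rewrite -(pPn n) mxE (bigD1 l)//= ltr_pwDl//.
  by rewrite mulr_gt0// lt0r pl p0.
by rewrite sumr_ge0// => k _; rewrite mulr_ge0.
Qed.

(** * Convergence to the coding measure *)

(** Makes the product of X and the alphabet one of the spaces on which probability
measures were compared above. *)
HB.instance Definition _ (R : numDomainType) (U V : pseudoPMetricType R) :=
  Pointed.on (U * V)%type.

Section convergence.
Context (R : realType) (X : pmetricType R) (cptX : compact [set: X]) (m : nat).
Context (P : transition_matrix R m) (T : symbol m -> continuousType X X).

Let Y : ptopologicalType := (X * symbol m)%type.

Lemma continuous_iter_transfer n (f : X * symbol m -> R) :
  continuous f -> continuous (iter n (transfer P T) f).
Proof. by move=> cf; elim: n => //= n ih; exact: continuous_transfer. Qed.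

Lemma Rintegral_iter_markov_operator n (mu : probability (borel Y) R)
    (f : X * symbol m -> R) : continuous f ->
  \int[iter n (markov_operator P T) mu]_z f z =
  \int[mu]_z iter n (transfer P T) f z.
Proof.
elim: n f => // n ih f cf.
rewrite iterS (Rintegral_markov_operator cptX P T _ cf) ih ?iterSr//.
exact: continuous_transfer.
Qed.

(** The bound on the functions may depend on n: it multiplies the measure of the
exceptional set, which is empty here. *)
Lemma cvg_Rintegral_iter_transfer (mu : probability (borel Y) R)
    (f : X * symbol m -> R) (c : R) : continuous f ->
  (forall e, 0 < e -> \forall n \near \oo, forall z,
    `|iter n (transfer P T) f z - c| <= e) ->
  \int[mu]_z iter n (transfer P T) f z @[n --> \oo] --> c.
Proof.
move=> cf h; apply/cvgrPdist_le => e e0; apply: filterS (h e e0) => n hn.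
rewrite distrC.
have cn := @continuous_iter_transfer n f cf.
have [M M0 hM] := continuous_bounded cptX cn.
rewrite -[X in _ - X](Rintegral_cst1 mu).
have -> : e = e + 2 * (M + `|c|) * fine (mu (~` setT)).
  by rewrite setCT measure0 mulr0 addr0.
apply: dist_Rintegral => //.
- exact: (@measurable_continuous_real _ Y _ cn).
- by move=> z; rewrite (le_trans (hM z))// lerDl.
- by move=> z; rewrite lerDr.
- exact: ltW.
Qed.

End convergence.

Theorem theorem5p5 (R : realType) (X : pmetricType R)
    (cptX : compact [set: X])
    (m : nat) (k_ge2 : (2 <= m.+1)%N)
    (T : symbol m -> continuousType X X)
    (P : transition_matrix R m) (p : 'rV[R]_m.+1)
    (Pplus Pminus : probability (borel (sequences m)) R)
    (P_irr : irreducible_mx P)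
    (p_stat : stationary_vector P p)
    (Pplus_markov : markov_measure P p Pplus)
    (Pminus_inv : inverse_measure Pplus Pminus)
    (Pminus_mixing : mixing Pminus)
    (Pminus_St : Pminus (weakly_hyperbolic T) = 1%E) :
  let S := markov_operator P T in
  let nu := gcoding_pushforward cptX Pminus_St in
  [/\ forall mu : probability (borel (X * symbol m)%type) R,
        (iter n S mu : weakstar R (X * symbol m)%type) @[n --> \oo] -->
          (nu : weakstar R (X * symbol m)%type),
      stationary_measure P T nu
    & forall mu : probability (borel (X * symbol m)%type) R,
        stationary_measure P T mu ->
        forall B : set (borel (X * symbol m)%type),
          measurable B -> mu B = nu B].
Proof.
move=> S nu.
have chain := inverse_measure_reversed_chain Pplus_markov Pminus_inv.
have cvg_int (mu : probability (borel (X * symbol m)%type) R)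
    (f : X * symbol m -> R) : continuous f ->
    \int[iter n S mu]_z f z @[n --> \oo] --> \int[nu]_z f z.
  move=> cf; rewrite (Rintegral_gcoding_pushforward cptX Pminus_St cf).
  under eq_cvg do rewrite (Rintegral_iter_markov_operator cptX P T _ _ cf).
  apply: cvg_Rintegral_iter_transfer => // e e0.
  (* The error e p_i is affordable since p_i > 0 and the alphabet is finite. *)
  have : \forall n \near \oo, forall i x, `|iter n (transfer P T) f (x, i) -
      \int[Pminus]_(xi in weakly_hyperbolic T) f (gcoding T xi)| <= e.
    apply: filter_forall => i.
    have pi0 := stationary_vector_gt0 i P_irr p_stat.
    have := iter_transfer_cvg cptX chain Pminus_mixing Pminus_St cf (mulr_gt0 pi0 e0).
    apply: filterS => n h x; rewrite -(ler_pM2l pi0).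
    by have := h x i; rewrite -mulrBr normrM gtr0_norm.
  by apply: filterS => n h [x i]; exact: h.
split => [mu||mu stat_mu].
- by apply/weakstar_cvgP => f; apply: cvg_int; exact: cts_fun.
- apply: (@probability_eq_continuous R (X * symbol m)%type (S nu) nu) => f cf.
  rewrite (Rintegral_markov_operator cptX P T nu cf).
  (* Both sides are limits of the integrals of f against the iterates of nu. *)
  have lim1 := cvg_int nu _ (continuous_transfer (P := P) (T := T) cf).
  have lim2 : \int[iter n S nu]_z transfer P T f z @[n --> \oo] --> \int[nu]_z f z.
    have -> : (fun n => \int[iter n S nu]_z transfer P T f z) =
        (fun n => \int[iter n.+1 S nu]_z f z).
      apply/funext => n.
      by rewrite iterS (Rintegral_markov_operator cptX P T (iter n S nu) cf).
    by have := cvg_int nu f cf; rewrite -cvg_shiftS.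
  exact: (cvg_unique _ lim1 lim2).
- apply: (@probability_eq_continuous R (X * symbol m)%type mu nu) => f cf.
  (* The integrals against the iterates of mu are constant and converge to those
     against nu. *)
  have intS (g : X * symbol m -> R) : continuous g ->
      \int[mu]_z transfer P T g z = \int[mu]_z g z.
    move=> cg; rewrite -(Rintegral_markov_operator cptX P T mu cg).
    by congr fine; apply: eq_measure_integral => B mB _; exact: stat_mu.
  have intSn n : \int[iter n S mu]_z f z = \int[mu]_z f z.
    rewrite (Rintegral_iter_markov_operator cptX P T n mu cf).
    elim: n => // n ih; rewrite iterS intS//; exact: continuous_iter_transfer.
  have := cvg_int mu f cf; under eq_fun do rewrite intSn.
  by move=> /(cvg_unique _ (cvg_cst _)); exact.
Qed.
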